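(* Let $G$ be a connected graph of order $n$ with vertex set $V$, and let $H\subseteq V$ be a connected set of size $h\geq 1$. Then \[A(G,H)\geq \frac{n+h}{2}.\]
   Context: A subset $U\subseteq V$ is a connected set if the subgraph of $G$ induced by $U$ is connected. For a connected set $H$, $N(G,H)$ denotes the number of connected sets of $G$ containing $H$, $S(G,H)$ the sum of the sizes of all connected sets of $G$ containing $H$, and $A(G,H)=S(G,H)/N(G,H)$ the average size of a connected set containing $H$. *)

(* Defs.v *)
From mathcomp Require Import all_boot all_order all_algebra.

Set Implicit Arguments.
Unset Strict Implicit.
Unset Printing Implicit Defensive.

(* A finite simple graph is a symmetric irreflexive adjacency relation on a
   finType of vertices. *)

Definition connected_graph (T : finType) (e : rel T) : bool :=
  [forall x : T, forall y : T, connect e x y].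

Definition induced (T : finType) (e : rel T) (U : {set T}) :
  rel {x : T | x \in U} := relpre val e.
Arguments induced {T} e U _ _.

(* The empty set is connected under this definition; it never contributes to
   the quantities below when H is nonempty. *)
Definition connected_set (T : finType) (e : rel T) (U : {set T}) : bool :=
  connected_graph (induced e U).

Definition connected_supersets (T : finType) (e : rel T) (H : {set T}) :
  {set {set T}} := [set U : {set T} | connected_set e U & H \subset U].

Definition Ncs (T : finType) (e : rel T) (H : {set T}) : nat :=
  #|connected_supersets e H|.

Definition Scs (T : finType) (e : rel T) (H : {set T}) : nat :=
  \sum_(U in connected_supersets e H) #|U|.

(* Ncs e H > 0 whenever the graph is connected: the full vertex set counts. *)
Definition Acs (T : finType) (e : rel T) (H : {set T}) : rat :=
  ((Scs e H)%:R / (Ncs e H)%:R)%R.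

(* Main.v *)
Require Import Defs.
From mathcomp Require Import all_boot all_order all_algebra.
From mathcomp Require Import zify.

(** Fix [v] outside [H] but adjacent to it, let [C] be the component of [G - v]
    containing [H] and [D] its complement, a connected set containing [v].  The
    connected sets containing [H] split into those containing [v] and those of
    [G[C]]; write [N1], [N2] for their numbers.  By induction on [n - h] their
    averages are at least [(n+h+1)/2] and [(n-|D|+h)/2], so it suffices that
    [N1 >= |D| N2].  This holds because joining a connected set of [G[C]]
    containing [H] to a connected set of [G[D]] containing [v] (of which there
    are at least [|D|], one of each size) gives a connected set. *)

Set Implicit Arguments.
Unset Strict Implicit.
Unset Printing Implicit Defensive.

Section ConnectedSets.

Variables (T : finType) (e : rel T).
Hypothesis e_sym : symmetric e.

Implicit Types (x y v : T) (A B U V W X Y Z H : {set T}).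

(** A path from inside [A] to outside it must cross an edge leaving [A]; conversely, the set of
    vertices reachable from [x] has no edge leaving it inside [U], so it is all of [U]. This form
    replaces paths in a subtype by single edges between vertices of [T]. *)
Lemma connected_set_cutP U :
  connected_set e U <->
  forall A, A \subset U -> A != set0 -> A != U ->
    exists a b, [/\ a \in A, b \in U :\: A & e a b].
Proof.
split=> [/forallP Uconn A sAU /set0Pn[x xA] AneqU | cutU].
  have /properP[_ [y yU yA]] : A \proper U by rewrite properEneq AneqU.
  have xU := subsetP sAU _ xA.
  have /forallP/(_ (Sub y yU))/connectP[p] := Uconn (Sub x xU).
  move=> pth lst.
  have : y = val (last (Sub x xU : {x : T | x \in U}) p) by rewrite -lst.
  elim: p (x) xA xU pth {lst} => [|[z zU] p IHp] w wA wU /=.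
    by move=> _ yw; rewrite yw wA in yA.
  case/andP=> ewz pth yE; have [zA|zA] := boolP (z \in A); first exact: IHp yE.
  by exists w, z; rewrite inE zA zU.
apply/forallP=> x; apply/forallP=> y.
pose A := [set val z | z : {x : T | x \in U} & connect (induced e U) x z].
have sAU : A \subset U by apply/subsetP=> _ /imsetP[z _ ->]; exact: valP.
have A_neq0 : A != set0.
  by apply/set0Pn; exists (val x); apply: imset_f; rewrite inE.
have [AU|/(cutU _ sAU A_neq0)] := eqVneq A U.
  have : val y \in A by rewrite AU; apply: valP.
  by case/imsetP=> z; rewrite inE => xz /val_inj ->.
case=> a [b [/imsetP[z]]]; rewrite !inE => xz -> /andP[/negP bA bU] ezb.
case: bA; apply/imsetP; exists (Sub b bU) => //.
by rewrite inE (connect_trans xz) // connect1.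
Qed.

Lemma connected_set1 v : connected_set e [set v].
Proof.
apply/connected_set_cutP=> A; rewrite subset1 => /orP[/eqP->|/eqP->].
  by rewrite eqxx.
by rewrite eqxx.
Qed.

(** If no edge of the union leaves [A], then [A] contains or misses each of [X] and [Y] entirely,
    and the link between [x] and [y] excludes the mixed cases. The disjunction covers both
    overlapping and adjacent sets. *)
Lemma connected_setU X Y x y :
    connected_set e X -> connected_set e Y -> x \in X -> y \in Y ->
  (x == y) || e x y -> connected_set e (X :|: Y).
Proof.
move=> /connected_set_cutP cX /connected_set_cutP cY xX yY xy.
apply/connected_set_cutP=> A sA A0 AXY.
have cut Z : Z \subset X :|: Y ->
    (forall B, B \subset Z -> B != set0 -> B != Z ->
      exists a b, [/\ a \in B, b \in Z :\: B & e a b]) ->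
    (exists a b, [/\ a \in A, b \in (X :|: Y) :\: A & e a b]) \/
    A :&: Z = set0 \/ Z \subset A.
  move=> sZ cZ; have [|AZ0] := eqVneq (A :&: Z) set0; first by right; left.
  have [AZ|AZ] := eqVneq (A :&: Z) Z; first by right; right; apply/setIidPr.
  left; have [a [b []]] := cZ _ (subsetIr A Z) AZ0 AZ.
  rewrite !inE => /andP[aA aZ] /andP[bAZ bZ] eab.
  exists a, b; split=> //; have := subsetP sZ _ bZ.
  by rewrite !inE => ->; rewrite bZ andbT in bAZ; rewrite bAZ.
have [//|[X0|XA]] := cut X (subsetUl _ _) cX;
  have [//|[Y0|YA]] := cut Y (subsetUr _ _) cY.
- by case/eqP: A0; rewrite -(setIidPl sA) setIUr X0 Y0 setU0.
- have xA : x \notin A by apply/negP=> xA; have := in_set0 x; rewrite -X0 inE xA xX.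
  have yA := subsetP YA _ yY.
  case/predU1P: xy => [xy|exy]; first by rewrite xy yA in xA.
  by exists y, x; rewrite !inE xA xX e_sym.
- have yA : y \notin A by apply/negP=> yA; have := in_set0 y; rewrite -Y0 inE yA yY.
  have xA := subsetP XA _ xX.
  case/predU1P: xy => [xy|exy]; first by rewrite -xy xA in yA.
  by exists x, y; rewrite !inE yA yY orbT.
- by case/eqP: AXY; apply/eqP; rewrite eqEsubset sA subUset XA.
Qed.

(** The upper bound [V] lets the induction pass to an induced subgraph without changing the vertex
    type. *)
Definition connected_between H V : {set {set T}} :=
  [set U | [&& connected_set e U, H \subset U & U \subset V]].

Lemma leq_card_connected_between1 V v :
  connected_set e V -> v \in V -> #|V| <= #|connected_between [set v] V|.
Proof.
move=> /connected_set_cutP cV vV.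
(* Start from [[set v]] and add the far end of an edge leaving the current set, until [V] is
   exhausted. *)
have grow k : k < #|V| ->
    exists2 W, W \in connected_between [set v] V & #|W| = k.+1.
  elim: k => [|k IHk] kV.
    by exists [set v]; rewrite ?cards1 // inE connected_set1 !sub1set inE eqxx.
  have [W] := IHk (ltnW kV); rewrite inE sub1set => /and3P[cW vW sWV] Wk.
  have [||a [b [aW]]] := cV W sWV; first by apply/set0Pn; exists v.
    by apply: contraTneq kV => <-; rewrite Wk ltnn.
  rewrite inE => /andP[bW bV] eab.
  exists (W :|: [set b]); last by rewrite setUC cardsU1 bW Wk.
  rewrite !inE sub1set inE vW subUset sWV sub1set bV !andbT.
  by apply: (connected_setU cW (connected_set1 b) aW (set11 b)); rewrite eab orbT.
have grow_ord (k : 'I_#|V|) :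
    exists W, W \in connected_between [set v] V /\ #|W| = k.+1.
  by have [W] := grow k (ltn_ord k); exists W.
have [f fP] := fin_all_exists grow_ord.
have f_inj : injective f.
  move=> i j fij; apply/val_inj/succn_inj.
  by rewrite -(fP i).2 -(fP j).2 fij.
rewrite -[X in X <= _]card_ord -(card_codom f_inj); apply: subset_leq_card.
by apply/subsetP=> _ /codomP[k ->]; case: (fP k).
Qed.

Lemma connected_between_component H V v :
    connected_set e V -> connected_set e H -> H != set0 -> H \subset V ->
    v \in V -> v \notin H ->
  exists C, [/\ connected_set e C, H \subset C, C \subset V :\ v,
    connected_between H (V :\ v) = connected_between H C &
    connected_set e (V :\: C)].
Proof.
move=> /connected_set_cutP cV cH /set0Pn[h hH] sHV vV vH.
(* The component of [H] in [V :\ v] is obtained as a maximal connected subset containing [H]. *)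
pose P U := connected_set e U && (U \subset V :\ v).
have PH : P H by rewrite /P cH subsetD1 sHV.
have [C /maxsetP[/andP[cC sC] maxC] sHC] := maxset_exists PH.
have hC := subsetP sHC _ hH.
exists C; split=> //.
  apply/setP=> U; rewrite !inE; apply/and3P/and3P=> -[cU sHU sU]; split=> //.
    (* [U] and [C] share [h], so their union is connected and maximality absorbs [U]. *)
    have <- : U :|: C = C; last exact: subsetUl.
    apply: maxC (subsetUr _ _); rewrite /P subUset sU sC !andbT.
    by apply: (connected_setU cU cC (subsetP sHU _ hH) hC); rewrite eqxx.
  exact: subset_trans sC.
have noedge a c : a \in V :\: C -> a != v -> c \in C -> ~~ e a c.
  rewrite inE => /andP[aC aV] av cinC; apply: contra aC => eac.
  have <- : [set a] :|: C = C; last by rewrite !inE eqxx.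
  apply: maxC (subsetUr _ _); rewrite /P subUset sub1set !inE av aV sC !andbT.
  by apply: (connected_setU (connected_set1 a) cC (set11 a) cinC); rewrite eac orbT.
(* An edge leaving [A] inside [V] cannot end in [C], by [noedge], so it stays in the complement of
   [C]. *)
have half A : A \subset V :\: C -> A != set0 -> v \notin A ->
    exists a b, [/\ a \in A, b \in (V :\: C) :\: A & e a b].
  move=> sA A0 vA.
  have [||a [b [aA]]] := cV A _ A0; first exact: subset_trans sA (subsetDl _ _).
    by apply: contraNneq vA => ->.
  rewrite inE => /andP[bA bV] eab; exists a, b; split=> //.
  rewrite !inE bA bV andbT; apply/negP=> bC.
  have av : a != v by apply: contraNneq vA => <-.
  by have := noedge _ _ (subsetP sA _ aA) av bC; rewrite eab.
apply/connected_set_cutP=> A sA A0 AD; have [vA|] := boolP (v \in A); last exact: half.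
(* When [A] contains [v], its complement does not; the edge found there is reversed by symmetry. *)
have [|||a [b []]] := half ((V :\: C) :\: A); first exact: subsetDl.
- by apply: contra AD => /eqP D0; rewrite eqEsubset sA -setD_eq0 D0 eqxx.
- by rewrite inE vA.
rewrite setDDr setDv set0U => aDA /setIP[_ bA] eab.
by exists b, a; rewrite e_sym.
Qed.

(** The average bound with denominators cleared. Both recursive cases decrease [#|V| - #|H|]: one
    adds [v] to [H], the other shrinks [V] to [C]. *)
Lemma connected_between_sum_ge H V :
    connected_set e V -> connected_set e H -> H != set0 -> H \subset V ->
  (#|V| + #|H|) * #|connected_between H V| <=
    2 * \sum_(U in connected_between H V) #|U|.
Proof.
have [m] := ubnP (#|V| - #|H|); elim: m => // m IHm in V H *.
move=> ltm cV cH H0 sHV.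
have [HV|HV] := eqVneq H V.
  rewrite -{}HV in cV sHV *.
  have -> : connected_between H H = [set H].
    apply/setP=> U; rewrite !inE -eqEsubset eq_sym.
    by case: eqP => [->|]; rewrite ?cV ?andbF.
  by rewrite cards1 big_set1; lia.
have [h [v [hH]]] := (connected_set_cutP V).1 cV H sHV H0 HV.
rewrite inE => /andP[vH vV] ehv.
have [C [cC sHC sCV famC cD]] :=
  connected_between_component cV cH H0 sHV vV vH.
have [sC vC] : C \subset V /\ v \notin C by apply/andP; rewrite -subsetD1.
set D := V :\: C in cD.
have vD : v \in D by rewrite inE vC.
have cvH : connected_set e (v |: H).
  by rewrite setUC; apply: (connected_setU cH (connected_set1 v) hH (set11 v)); rewrite ehv orbT.
have svHV : v |: H \subset V by rewrite subUset sub1set vV.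
set F1 := connected_between (v |: H) V; set F2 := connected_between H C.
have F1E : [set U in connected_between H V | v \in U] = F1.
  apply/setP=> U; rewrite !inE subUset sub1set.
  by case: (v \in U); rewrite ?andbF ?andbT /= ?andbF.
have F2E : [set U in connected_between H V | v \notin U] = F2.
  apply/setP=> U; rewrite /F2 -famC !inE subsetD1.
  by rewrite -!andbA.
have cardF : #|connected_between H V| = #|F1| + #|F2|.
  rewrite -F1E -F2E -!sum1_card (bigID (fun U => v \in U)) /=.
  by congr (_ + _); apply: eq_bigl => U; rewrite !inE.
have sumF : \sum_(U in connected_between H V) #|U| =
    \sum_(U in F1) #|U| + \sum_(U in F2) #|U|.
  rewrite -F1E -F2E (bigID (fun U => v \in U)) /=.
  by congr (_ + _); apply: eq_bigl => U; rewrite !inE.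
have leF : #|F2| * #|D| <= #|F1|.
  apply: leq_trans (leq_mul (leqnn _) (leq_card_connected_between1 cD vD)) _.
  (* The union map is injective on these pairs: intersecting with [C] recovers the first set and
     removing [C] recovers the second. *)
  rewrite -cardsX -(card_in_imset (f := fun p => p.1 :|: p.2)); last first.
    move=> [U W] [U' W'] /setXP[UF WF] /setXP[UF' WF'] /= UW.
    move: UF WF UF' WF'; rewrite !inE => /and3P[_ _ sU] /and3P[_ _ sW].
    move=> /and3P[_ _ sU'] /and3P[_ _ sW'].
    have CE X Y : X \subset C -> Y \subset D ->
        (X :|: Y) :&: C = X /\ (X :|: Y) :\: C = Y.
      rewrite subsetD => sX /andP[_ dY].
      rewrite setIUl setDUl (setIidPl sX) (disjoint_setI0 dY) setU0.
      by rewrite (setDidPl dY) (eqP (_ : X :\: C == set0)) ?set0U // setD_eq0.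
    have [E1 E2] := CE _ _ sU' sW'.
    by have := CE _ _ sU sW; rewrite UW E1 E2 => -[-> ->].
  apply/subset_leq_card/subsetP=> _ /imsetP[[U W] /setXP[UF WF] ->].
  move: UF WF; rewrite !inE sub1set => /and3P[cU sHU sU] /and3P[cW vW sW].
  rewrite !subUset sub1set inE vW orbT (subset_trans sHU (subsetUl _ _)).
  rewrite (subset_trans sU sC) (subset_trans sW (subsetDl _ _)) !andbT.
  by apply: (connected_setU cU cW (subsetP sHU _ hH) vW); rewrite ehv orbT.
have cardV : #|V| = #|C| + #|D| by rewrite -(cardsID C V) (setIidPr sC).
have D_gt0 : 0 < #|D| by apply/card_gt0P; exists v.
have leHC := subset_leq_card sHC.
have ltCV : #|C| - #|H| < m by clear -ltm cardV D_gt0 leHC; lia.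
have cardvH : #|v |: H| = #|H|.+1 by rewrite cardsU1 vH.
have ltvH : #|V| - #|v |: H| < m.
  by rewrite cardvH; clear -ltm cardV D_gt0 leHC; lia.
have vH0 : v |: H != set0 by apply/set0Pn; exists v; rewrite !inE eqxx.
have le1 := IHm _ _ ltvH cV cvH vH0 svHV.
have le2 := IHm _ _ ltCV cC cH H0 sHC.
rewrite cardF sumF [X in _ <= X]mulnDr; apply: leq_trans (leq_add le1 le2).
(* What remains is [(c + d + h) * (n1 + n2) <= (c + d + h + 1) * n1 + (c + h) * n2], which reduces
   to [d * n2 <= n1], that is [leF]. *)
rewrite cardvH cardV; move: leF; clear; move: #|F1| #|F2| #|C| #|D| #|H|.
by move=> n1 n2 c d h; rewrite !mulnDl ![n2 * _]mulnC; lia.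
Qed.

End ConnectedSets.

Theorem theorem3p1 (T : finType) (e : rel T)
  (e_sym : symmetric e) (e_irr : irreflexive e)
  (G_conn : connected_graph e)
  (H : {set T}) (H_conn : connected_set e H) (H_gt0 : 1 <= #|H|) :
  ((#|T| + #|H|)%:R / 2%:R <= Acs e H)%R.
Proof.
(* Connectedness of the graph is lifted to the subtype of the full set by mapping paths along
   [f]. *)
have T_conn : connected_set e [set: T].
  pose f z : {x : T | x \in [set: T]} := Sub z (in_setT z).
  have fK x : f (val x) = x by apply: val_inj.
  apply/forallP=> x; apply/forallP=> y.
  have /forallP/(_ (val y))/connectP[p pth lst] := (forallP G_conn) (val x).
  apply/connectP; exists (map f p); rewrite -(fK x) ?path_map //.
  by rewrite last_map -lst fK.
have famE : connected_between e H [set: T] = connected_supersets e H.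
  by apply/setP=> U; rewrite !inE subsetT andbT.
have H_neq0 : H != set0 by rewrite -card_gt0.
have := connected_between_sum_ge e_sym T_conn H_conn H_neq0 (subsetT H).
rewrite famE cardsT -/(Ncs e H) -/(Scs e H) => le_sum.
(* [H] itself is counted, so the denominator of the average can be cleared. *)
have N_gt0 : 0 < Ncs e H.
  by apply/card_gt0P; exists H; rewrite inE H_conn subxx.
rewrite /Acs Num.Theory.ler_pdivlMr ?Num.Theory.ltr0n //.
rewrite GRing.mulrAC Num.Theory.ler_pdivrMr ?Num.Theory.ltr0n //.
by rewrite -!GRing.natrM Num.Theory.ler_nat [X in _ <= X]mulnC.
Qed.
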